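(* Assume $2^{<\mathfrak{c}} = \mathfrak{c}$. Let $X$ be a regular Hausdorff space such that $\hat{F}(X) \leq \mathfrak{c}$ and $|\overline{D}| \leq \mathfrak{c}$ for every discrete $D \subset X$. Then $|X| \leq \mathfrak{c}$.
   Context: All spaces are Hausdorff. $\mathfrak{c} = 2^{\aleph_0}$ and $2^{<\mathfrak{c}} = \sup\{2^\lambda : \lambda < \mathfrak{c}\}$. A subset of $X$ is discrete if its subspace topology is discrete (it need not be closed). A sequence $\{x_\alpha : \alpha < \kappa\}$ of points of $X$ ($\kappa$ an ordinal) is free if for every $\gamma < \kappa$ we have $\overline{\{x_\alpha : \alpha \leq \gamma\}} \cap \overline{\{x_\alpha : \alpha > \gamma\}} = \emptyset$; a subset of $X$ is called a free sequence if it can be enumerated as one. $\hat{F}(X) = \min\{\kappa : \text{if } A \subset X \text{ and } |A| = \kappa \text{ then } A \text{ is not a free sequence}\}$. *)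

(* Defs.v *)
(* Cardinals are represented by types up to equipotency, the cardinal of T
   being that of [set: T]; the powerset type [set T] represents 2 ^ |T|. *)
From mathcomp Require Import all_boot all_classical.
From mathcomp Require Import wochoice topology.

Set Implicit Arguments.
Unset Strict Implicit.
Unset Printing Implicit Defensive.

Local Open Scope classical_set_scope.
Local Open Scope card_scope.

Definition continuum : Type := set nat.

Definition card_lt (T U : Type) : Prop :=
  [set: T] #<= [set: U] /\ ~ ([set: U] #<= [set: T]).

(* S represents 2 ^ {< K}: it is the least upper bound of the cardinals
   2 ^ |L| for |L| < |K| *)
Definition is_weak_power (K S : Type) : Prop :=
  (forall L : Type, card_lt L K -> [set: set L] #<= [set: S]) /\
  (forall T : Type,
     (forall L : Type, card_lt L K -> [set: set L] #<= [set: T]) ->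
     [set: S] #<= [set: T]).

(* the type set_type D carries the topology induced by X *)
Definition discrete_subset (X : topologicalType) (D : set X) : Prop :=
  forall U : set (set_type D), open U.

(* The ordinal indexing the sequence is represented by a type I together with
   a reflexive well-order R (to be read as <=), so that ~~ R a g means g < a.
   Freeness makes x injective. *)
Definition free_enumeration (X : topologicalType) (I : Type) (R : rel I)
    (x : I -> X) : Prop :=
  well_order R /\
  forall g : I, closure (x @` [set a | R a g])
                  `&` closure (x @` [set a | ~~ R a g]) = set0.

Definition free_sequence (X : topologicalType) (A : set X) : Prop :=
  exists (I : Type) (R : rel I) (x : I -> X),
    free_enumeration R x /\ A = range x.

Definition no_free_sequence_of_card (X : topologicalType) (K : Type) : Prop :=
  forall A : set X, A #= [set: K] -> ~ free_sequence A.

(* K represents \hat F(X) *)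
Definition is_hatF (X : topologicalType) (K : Type) : Prop :=
  no_free_sequence_of_card X K /\
  forall L : Type, no_free_sequence_of_card X L -> [set: K] #<= [set: L].

(* Main.v *)
Require Import Defs.
From mathcomp Require Import all_boot all_classical.
From mathcomp Require Import wochoice topology.

Local Open Scope classical_set_scope.
Local Open Scope card_scope.

(** Write c for the continuum. Two facts carry the proof.

    First, every closed set F of X is the intersection of at most c open sets
    ([closed_pseudocharacter]). By regularity each point d outside F has an
    open neighbourhood U d whose closure misses F. Going through X along a
    well-order and keeping a point when it is outside F, outside the closure
    of the points kept so far and outside their neighbourhoods, one gets a
    discrete set D such that the U d, for d in the closure of D and outside F,
    cover the complement of F. The closure of D has at most c points, and the
    complements of the closures of these U d intersect in F.

    Second, fix for each set A such a family V A i, with i in c, for the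
    closure of A. Given p in X, build a sequence x in which the S b, the set
    of terms of index less than b, serve to choose an index t b with p outside
    V (S b) (t b), as long as p is not in the closure of S b; the term x g is
    then a fixed choice of a point outside all the V (S b) (t b) with b <= g,
    and such a point exists since p is one. Every V (S b) (t b) contains the
    closure of the terms before b and no term from b on, so the sequence is
    free and its set of terms is discrete. Let the indices run through an
    initial ordinal of cardinal c. As no free sequence has c terms, p belongs
    to the closure of S g for a least g = gamma p
    ([captured_by_branches]).

    The point p entered the construction only through the indices t: the set
    S (gamma p) is determined by gamma p and by the restriction of t to the
    indices below gamma p. For each g < c there are at most c ^ |g| such
    restrictions, which is at most c because c ^ |g| = (2 ^ |g|) ^ aleph_0 and
    2 ^ |g| <= c. Each of these at most c discrete sets has a closure of at
    most c points, and these closures cover X. *)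

(** * Well-orders *)

(** For a total order read as <=, the negation of [g <= b] is [b < g]; stating
    the strict order in this way requires no equality test on [I]. *)
Definition below {I : Type} (R : rel I) (g : I) : set I := [set b | ~~ R g b].

Section WellOrder.
Context {I : Type} {R : rel I} (woR : well_order R).

Lemma well_order_min (A : set I) :
  A !=set0 -> exists2 z, A z & forall y, A y -> R z y.
Proof.
case=> a Aa; have [|z [[/asboolP Az lez] _]] := woR [pred y | `[< A y >]].
  by exists a; apply/asboolP.
by exists z => // y Ay; apply: lez; apply/asboolP.
Qed.

Lemma well_order_total a b : R a b \/ R b a.
Proof.
have [|z [->|->] lez] := well_order_min [set a; b]; first by exists a; left.
  by left; apply: lez; right.
by right; apply: lez; left.
Qed.

Lemma well_order_refl a : R a a.
Proof. by case: (well_order_total a a). Qed.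

Lemma well_order_anti a b : R a b -> R b a -> a = b.
Proof.
move=> ab ba; have [|z [_ uniq_z]] := woR [pred y | `[< [set a; b] y >]].
  by exists a; apply/asboolP; left.
have za : z = a.
  apply: uniq_z; split; first by apply/asboolP; left.
  by move=> y /asboolP [] ->; [exact: well_order_refl|].
have zb : z = b.
  apply: uniq_z; split; first by apply/asboolP; right.
  by move=> y /asboolP [] ->; [|exact: well_order_refl].
by rewrite -za -zb.
Qed.

Lemma well_order_trans a b c : R a b -> R b c -> R a c.
Proof.
move=> ab bc.
have [|z zabc lez] := well_order_min [set y | [\/ y = a, y = b | y = c]].
  by exists a; constructor 1.
have [za zb zc] : [/\ R z a, R z b & R z c].
  by split; apply: lez; [constructor 1|constructor 2|constructor 3].
case: zabc => zE; subst z => //.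
  by rewrite (well_order_anti a b ab za).
by rewrite -(well_order_anti b c bc zb).
Qed.

Lemma well_order_lt_wf : well_founded (fun a b => ~~ R b a).
Proof.
move=> a; apply: contrapT => nAcc.
have [|z nAz lez] := well_order_min [set b | ~ Acc (fun a b => ~~ R b a) b].
  by exists a.
apply: nAz; constructor=> y ltyz; apply: contrapT => /lez.
by move/negP: ltyz.
Qed.

Lemma well_order_lt_trans a b c : ~~ R b a -> R b c -> ~~ R c a.
Proof. by move=> + bc; apply: contra => ca; apply: well_order_trans bc ca. Qed.

Lemma well_order_ltW a b : ~~ R b a -> R a b.
Proof. by move=> /negP ltab; case: (well_order_total a b). Qed.

(** The hypothesis on [G] replaces a dependently typed step function: since
    [G g] only looks at values below [g], the missing values can be filled
    with [t0]. *)
Lemma well_order_rec {T : Type} (t0 : T) (G : I -> (I -> T) -> T) :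
  (forall g u v, {in below R g, u =1 v} -> G g u = G g v) ->
  exists x : I -> T, forall g, x g = G g x.
Proof.
move=> localG.
pose step g (rec : forall a, ~~ R g a -> T) : T :=
  G g (fun a => if pselect (~~ R g a) is left h then rec a h else t0).
exists (Fix well_order_lt_wf (fun=> T) step) => g.
rewrite Fix_eq; last first.
  by move=> a u v uv; apply: localG => b _; case: pselect.
by apply: localG => a /set_mem ltag; case: pselect.
Qed.

End WellOrder.

Lemma well_order_pullback {I J : Type} (R : rel I) (f : J -> I) :
  injective f -> well_order R -> well_order (fun a b => R (f a) (f b)).
Proof.
move=> injf woR; apply: antisymmetric_well_order.
  by move=> a b /andP[ab ba]; apply: injf; apply: well_order_anti woR _ _ ab ba.
move=> A [a Aa].
have [|z [b Ab <-] lez] := well_order_min woR (f @` [set b | b \in A]).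
  by exists (f a), a.
by exists b; split=> // y Ay; apply: lez; exists y.
Qed.

(** The initial ordinal of [K]: in an arbitrary well-order of [K], keep the
    elements that lie below every element whose initial segment is as large as
    [K]. Either there is no such element and everything is kept, or what is
    kept is the initial segment of the least one; in both cases the cardinal
    is that of [K]. *)
Lemma ex_initial_well_order (K : Type) :
  exists (I : Type) (R : rel I),
    [/\ well_order R, [set: I] #= [set: K] &
        forall g, ~ ([set: K] #<= below R g)].
Proof.
have [R0 woR0] := well_ordering_principle {classic K}.
pose A := [set b : K | forall a, R0 a b -> ~ ([set: K] #<= below R0 a)].
have AK : A #= [set: K].
  apply/card_eqPle; split; first exact: card_leT.
  have [[a Ka]|noK] := pselect (exists a, [set: K] #<= below R0 a); last first.
    by rewrite (_ : A = setT) // -subTset => b _ a _ Ka; apply: noK; exists a.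
  have [|z Kz lez] := well_order_min woR0 [set a | [set: K] #<= below R0 a].
    by exists a.
  apply: card_le_trans Kz _; apply: subset_card_le => b ltbz c lecb /lez lezc.
  move/negP: ltbz; apply.
  exact: (well_order_trans woR0 z c b).
pose R (a b : set_type A) := R0 (val a) (val b).
exists (set_type A), R; split.
- exact: well_order_pullback val_inj woR0.
- by rewrite (card_eql (card_setT A)).
- move=> g Kg; have /set_mem Ag := valP g.
  apply: (Ag (val g)); first exact: well_order_refl.
  apply: card_le_trans Kg _.
  rewrite -(card_le_eql (inj_card_eq (f := val) _)); last first.
    by move=> ? ? _ _; apply: val_inj.
  by apply: subset_card_le => _ [b ltbg <-].
Qed.

(** * Cardinal arithmetic of the continuum *)

Lemma inj_card_leT {T U : Type} (f : T -> U) :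
  injective f -> [set: T] #<= [set: U].
Proof.
move=> injf; rewrite -(card_le_eql (inj_card_eq (f := f) _)); first exact: card_leT.
by move=> ? ? _ _; apply: injf.
Qed.

Lemma card_leT_inj {T U : Type} :
  [set: T] #<= [set: U] -> exists f : T -> U, injective f.
Proof.
move=> /card_leP[f]; exists (fun t => val (f (exist _ t (in_setT t)))) => a b.
by move=> /val_inj /(inj (in_setT _) (in_setT _)) [].
Qed.

(** The injection behind c ^ aleph_0 = c. *)
Definition uncurry_code (u : nat -> continuum) : continuum :=
  [set k | exists n m, k = choice.pickle (n, m) /\ u n m].

Lemma uncurry_code_inj : injective uncurry_code.
Proof.
have codeE (u : nat -> continuum) n m :
    uncurry_code u (choice.pickle (n, m)) <-> u n m.
  split=> [[n' [m' [e umn]]]|unm]; last by exists n, m.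
  by have [-> ->] := pcan_inj choice.pickleK e.
move=> u v uv; apply/funext => n; apply/seteqP; split=> m.
  by rewrite -(codeE u) uv codeE.
by rewrite -(codeE v) -uv codeE.
Qed.

(** c ^ |L| = (2 ^ |L|) ^ aleph_0 <= c ^ aleph_0 = c: a function from [L] to
    the subsets of nat is the sequence of the sets [[set l | u l n]].
    Exchanging the two arguments in this way avoids proving
    |L| * aleph_0 < c. *)
Lemma card_fun_continuum (L : Type) :
  [set: set L] #<= [set: continuum] ->
  [set: L -> continuum] #<= [set: continuum].
Proof.
move=> /pcard_injP[f injf].
apply: (inj_card_leT (fun u => uncurry_code (fun n => f [set l | u l n]))).
move=> u v /uncurry_code_inj uv; apply/funext => l; apply/seteqP.
have uvn n : [set l | u l n] = [set l | v l n].
  by apply: injf; rewrite ?inE //; apply: (congr1 (@^~ n) uv).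
by split=> n; [move: (uvn n) | move: (esym (uvn n))] => /seteqP[+ _] => /(_ l).
Qed.

(** * Discrete and free sequences *)

(** A neighbourhood that excludes the later terms, minus the closure of the
    earlier ones, isolates a term. *)
Lemma separated_discrete {X : topologicalType} {I : Type} (R : rel I)
    (J : set I) (x : I -> X) :
  well_order R ->
  (forall a, J a -> exists U,
     [/\ open U, U (x a) & forall b, J b -> ~~ R b a -> ~ U (x b)]) ->
  (forall a, J a -> ~ closure (x @` (J `&` below R a)) (x a)) ->
  discrete_subset (x @` J).
Proof.
move=> woR right_sep left_sep P.
have /choice[W WP] : forall d : set_type (x @` J), exists W,
    open W /\ forall e, W (val e) <-> e = d.
  case=> _d dJ; have /set_mem[a Ja xa] := dJ; subst _d.
  have [U [oU Ua Ub]] := right_sep a Ja.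
  exists (U `&` ~` closure (x @` (J `&` below R a))); split.
    by apply: openI => //; apply/closed_openC/closed_closure.
  case=> _e eJ; have /set_mem[b Jb xb] := eJ; subst _e.
  split=> [[/= Uxb nclb]|/(congr1 val) /= ->]; last first.
    by split=> //; exact: left_sep.
  apply: val_inj => /=; have [ab|ltba] := boolP (R a b); last first.
    by exfalso; apply/nclb/subset_closure; exists b.
  have [ba|ltab] := boolP (R b a); last by have := Ub b Jb ltab.
  by rewrite (well_order_anti woR a b ab ba).
exists (\bigcup_(d in P) W d); first by apply: bigcup_open => d _; case: (WP d).
apply/seteqP; split=> [e [d Pd]|e Pe].
  rewrite /set_val /= => We.
  by have [_ /(_ e) [-> //]] := WP d.
by exists e => //; have [_ /(_ e) [_]] := WP e; apply.
Qed.

(** The set [W g] holds the closure of the terms before [g] and none of the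
    terms from [g] on. A term [x a] is thus outside the closure of the earlier
    terms, because it avoids [W a], and is separated from the later ones by
    [W s], where [s] is the successor of [a]. *)
Lemma trapped_discrete {X : topologicalType} {I : Type} (R : rel I)
    (J : set I) (x : I -> X) (W : I -> set X) :
  well_order R ->
  (forall a b, J b -> R a b -> J a) ->
  (forall g, J g -> open (W g) /\ closure (x @` below R g) `<=` W g) ->
  (forall g b, J g -> R b g -> ~ W b (x g)) ->
  discrete_subset (x @` J).
Proof.
move=> woR downJ inW outW; apply: (separated_discrete _ _ _ woR) => a Ja.
  (* When [a] is the last index of [J] it has no successor in [J], and any
     neighbourhood will do. *)
  have [[b [Jb ltab]]|amax] := pselect (exists b, J b /\ ~~ R b a); last first.
    exists setT; split=> [|//|b Jb ltab]; first exact: openT.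
    by exfalso; apply: amax; exists b.
  have [|s ltas les] := well_order_min woR [set b | ~~ R b a]; first by exists b.
  have [oW clW] := inW s (downJ s b Jb (les b ltab)).
  exists (W s); split=> // [|c Jc ltac]; last by apply: outW => //; apply: les.
  by apply/clW/subset_closure; exists a.
have [_ clW] := inW a Ja.
move=> /(closureS (B := x @` below R a)) cla.
apply: (outW a a Ja (well_order_refl woR a)); apply/clW/cla.
by move=> _ [b [_ ltba] <-]; exists b.
Qed.

(** The same sets [W] separate the initial segments from the rest: with [s]
    the successor of [g], the terms up to [g] have their closure in the open
    set [W s], which the terms beyond [g] avoid. *)
Lemma trapped_free {X : topologicalType} {I : Type} (R : rel I)
    (x : I -> X) (W : I -> set X) :
  well_order R ->
  (forall g, open (W g) /\ closure (x @` below R g) `<=` W g) ->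
  (forall g b, R b g -> ~ W b (x g)) ->
  free_enumeration R x.
Proof.
move=> woR inW outW; split=> // g.
have [[b ltgb]|gmax] := pselect (exists b, ~~ R b g); last first.
  rewrite (_ : [set a | ~~ R a g] = set0); last first.
    by rewrite -subset0 => a ltga; apply: gmax; exists a.
  by rewrite image_set0 closure0 setI0.
have [|s ltgs les] := well_order_min woR [set b | ~~ R b g]; first by exists b.
have [oW clW] := inW s.
rewrite -subset0 => z [zl zr].
have Wz : W s z.
  apply: clW; apply: closureS zl; apply: image_subset => a leag.
  by apply: contra ltgs => lesa; apply: (well_order_trans woR s a g).
have : closure (~` W s) z.
  apply: closureS zr => _ [a ltga <-].
  by apply: outW; apply: les.
by rewrite -(closure_id _).1 //; apply: open_closedC.
Qed.

(** A free sequence stays free when restricted to a subset of its indices, so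
    forbidding the cardinal [K] forbids every longer sequence. *)
Lemma no_free_enumeration {X : topologicalType} {K I : Type} (R : rel I)
    (x : I -> X) :
  no_free_sequence_of_card X K -> [set: K] #<= [set: I] ->
  ~ free_enumeration R x.
Proof.
move=> noK /card_leT_inj[f injf] [woR freex].
have lt_neq a b : ~~ R b a -> x a <> x b.
  move=> ltab xab; suff : set0 (x a) by [].
  rewrite -(freex a); split; apply: subset_closure.
    by exists a => //; apply: well_order_refl.
  by exists b.
have injx : injective x.
  move=> a b xab; apply: (well_order_anti woR).
    by apply/negPn/negP => /lt_neq; apply.
  by apply/negPn/negP => /lt_neq; apply.
apply: (noK (range (x \o f))).
  by apply: inj_card_eq => a b _ _ /injx /injf.
exists K, (fun a b => R (f a) (f b)), (x \o f); split=> //; split.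
  exact: well_order_pullback.
move=> g; rewrite -subset0 -(freex (f g)) => z [zl zr].
by split; [apply: closureS zl|apply: closureS zr];
  move=> _ [a ? <-]; exists (f a).
Qed.

(** * The pseudocharacter of closed sets *)

(** A version of Shapirovskii's covering lemma: the discrete set [D] obtained
    greedily along a well-order of [X] satisfies [~` F `<=` closure D `|`
    \bigcup_(y in D) U y]. A point of [closure D] outside [F] belongs to its
    own [U], so that [closure D] indexes a cover of the complement of [F]. *)
Lemma closed_pseudocharacter {X : topologicalType} {K : pointedType}
    (F : set X) :
  regular_space X ->
  (forall D : set X, discrete_subset D -> closure D #<= [set: K]) ->
  closed F ->
  exists V : K -> set X,
    (forall i, open (V i) /\ F `<=` V i) /\
    (forall p, ~ F p -> exists i, ~ V i p).
Proof.
move=> regX leK clF.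
have /choice[U UP] : forall p, exists U,
    ~ F p -> [/\ open U, U p & closure U `<=` ~` F].
  move=> p; have [Fp|nFp] := pselect (F p); first by exists setT.
  have : nbhs p (~` F) by apply: open_nbhs_nbhs; split=> //; exact: closed_openC.
  move=> /regX[B pB clB]; exists B° => _; split=> //; first exact: open_interior.
  by move=> z /(closureS (@interior_subset _ B)) /clB.
have [R woR] := well_ordering_principle X.
pose G (g : X) (D : set X) : Prop :=
  [/\ ~ F g, ~ closure (D `&` below R g) g &
      ~ (\bigcup_(y in D `&` below R g) U y) g].
have [|D DE] := @well_order_rec X R woR Prop True G.
  move=> g A B AB; rewrite /G; suff -> : A `&` below R g = B `&` below R g by [].
  by apply/seteqP; split=> y [Ay yg]; split=> //;
    [rewrite -AB|rewrite AB] => //; apply/mem_set.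
have discD : discrete_subset D.
  rewrite -[D]image_id; apply: (separated_discrete _ _ _ woR) => a Da.
    have [nFa _ _] : G a D by rewrite -DE.
    have [oU Ua _] := UP a nFa; exists (U a); split=> // b Db ltab.
    have [_ _ nUb] : G b D by rewrite -DE.
    by move=> Uab; apply: nUb; exists a.
  by rewrite image_id; have [_] : G a D by rewrite -DE.
have /pcard_injP[e inje] := leK D discD.
(* A value [k] that is not the code of a point of [closure D] outside [F]
   makes the condition void and gives the whole space. *)
exists (fun k => [set z | forall d, closure D d -> ~ F d -> e d = k ->
                           ~ closure (U d) z]); split.
  move=> k; split; last first.
    by move=> z Fz d _ nFd _ Udz; have [_ _ /(_ z Udz)] := UP d nFd.
  have [[d [Dd nFd edk]]|nod] :=
      pselect (exists d, [/\ closure D d, ~ F d & e d = k]).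
    rewrite [X in open X](_ : _ = ~` closure (U d)).
      exact/closed_openC/closed_closure.
    apply/seteqP; split=> [z|z nUz c Dc nFc eck]; first exact.
    by rewrite (inje c d) ?inE // eck edk.
  rewrite [X in open X](_ : _ = setT); first exact: openT.
  by rewrite -subTset => z _ d Dd nFd edk; exfalso; apply: nod; exists d.
move=> p nFp.
suff [d [Dd nFd Udp]] : exists d, [/\ closure D d, ~ F d & U d p].
  by exists (e d) => /(_ d Dd nFd erefl); apply; apply: subset_closure.
have [clDp|nclDp] := pselect (closure D p).
  by exists p; split=> //; have [] := UP p nFp.
apply: contrapT => noU; apply: nclDp; apply: subset_closure.
rewrite DE; split=> //.
  by move=> clDp; apply: noU; exists p; split=> //;
    [apply: closureS clDp => ? [] | have [] := UP p nFp].
move=> [y [Dy _] Uyp]; apply: noU; exists y; split=> //; first exact: subset_closure.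
by have [nFy] : G y D by rewrite -DE.
Qed.

(** * Capturing each point by a discrete set *)

(** The branch of [p]: [t p b] is an index of an open set around the closure
    of the terms before [b] that excludes [p], and [x p g] is picked outside
    all the open sets designated up to stage [g]. The picking function and
    its default [p0] are the same for all points, which makes the terms
    depend on [p] through [t p] only; hence the last conclusion. *)
Lemma captured_by_branches {X : topologicalType} {K : pointedType} {I : Type}
    (R : rel I) (p0 : X) (V : set X -> K -> set X) :
  well_order R ->
  (forall S i, open (V S i) /\ closure S `<=` V S i) ->
  (forall S p, ~ closure S p -> exists i, ~ V S i p) ->
  (forall x : I -> X, ~ free_enumeration R x) ->
  exists (S : X -> set X) (gamma : X -> I) (t : X -> I -> K),
    [/\ forall p, discrete_subset (S p),
        forall p, closure (S p) p &
        forall p q, gamma p = gamma q ->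
          {in below R (gamma p), t p =1 t q} -> S p = S q].
Proof.
move=> woR VP Vsep nofree.
have /choice[tau tauP] : forall pS : X * set X, exists i,
    ~ closure pS.2 pS.1 -> ~ V pS.2 i pS.1.
  move=> [p S] /=; have [|/Vsep[i Vi]] := pselect (closure S p).
    by exists point.
  by exists i.
(* The bound [b <= g] is not strict: [x g] also avoids the open set around
   the closure of the terms before [g], hence is outside that closure. *)
pose adm p (x : I -> X) g : set X :=
  [set y | forall b, R b g ->
    ~ V (x @` below R b) (tau (p, x @` below R b)) y].
have /choice[x xE] : forall p, exists x : I -> X,
    forall g, x g = xget p0 (adm p x g).
  move=> p; apply: (well_order_rec woR p0) => g u v uv; congr xget.
  suff uvb b : R b g -> u @` below R b = v @` below R b.
    by apply/seteqP; split=> y uy b lebg; [rewrite -uvb|rewrite uvb] => //;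
      apply: uy.
  move=> lebg; apply: eq_imagel => a ltab; apply/uv/mem_set.
  exact: well_order_lt_trans ltab lebg.
pose S p g := x p @` below R g.
pose t p g := tau (p, S p g).
(* The point [p] itself shows that there is something to pick, as long as it
   has not been captured. *)
have avoid p g : (forall b, R b g -> ~ closure (S p b) p) ->
    forall b, R b g -> ~ V (S p b) (t p b) (x p g).
  move=> ncl; rewrite xE; apply: (xgetPex p0 (P := adm p (x p) g)).
  by exists p => b /ncl; apply: (tauP (p, S p b)).
have /choice[gamma gammaP] : forall p, exists g,
    closure (S p g) p /\ forall b, closure (S p b) p -> R g b.
  move=> p; suff [g clg] : exists g, closure (S p g) p.
    have [|z clz lez] := well_order_min woR [set g | closure (S p g) p].
      by exists g.
    by exists z.
  apply: contrapT => ncl.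
  apply: (nofree (x p)).
  apply: (trapped_free _ _ (fun g => V (S p g) (t p g)) woR) => [g|g b].
    exact: VP.
  by apply: avoid => c _ clc; apply: ncl; exists c.
exists (fun p => S p (gamma p)), gamma, t; split=> [p|p|p q gpq tpq].
- apply: (trapped_discrete _ _ _ (fun g => V (S p g) (t p g)) woR).
  + move=> a b ltbg leab; apply: contra ltbg => legb.
    exact: (well_order_trans woR _ a).
  + by move=> g _; apply: VP.
  + move=> g b ltg; apply: avoid => c lecg clc.
    move/negP: ltg; apply; have [_ /(_ c clc) legc] := gammaP p.
    exact: (well_order_trans woR _ c).
- by have [] := gammaP p.
- rewrite /S -gpq; apply: eq_imagel.
  apply: (well_founded_ind (well_order_lt_wf woR)) => a IH ltag.
  rewrite !xE; congr xget.
  suff Sb b : R b a -> S p b = S q b /\ t p b = t q b.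
    rewrite /adm; apply/seteqP; split=> y py b leba; move: (py b leba);
    by have [Sb_eq tb_eq] := Sb b leba; rewrite -/(S p b) -/(S q b)
      -/(t p b) -/(t q b) Sb_eq tb_eq.
  move=> leba; split.
    apply: eq_imagel => c ltcb; have ltca := well_order_lt_trans woR _ _ _ ltcb leba.
    apply: IH => //; exact: (well_order_lt_trans woR _ _ _ ltca (well_order_ltW woR _ _ ltag)).
  apply/tpq/mem_set; apply: contra ltag => legb.
  exact: (well_order_trans woR _ b).
Qed.

(** * The cardinality bound *)

Theorem theorem3p11
  (weak_power_c : is_weak_power continuum continuum)
  (X : topologicalType)
  (regX : regular_space X) (hausX : hausdorff_space X)
  (hatF : Type) (hatFP : is_hatF X hatF)
  (hatF_le_c : [set: hatF] #<= [set: continuum])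
  (closure_le_c : forall D : set X, discrete_subset D ->
     closure D #<= [set: continuum]) :
  [set: X] #<= [set: continuum].
Proof.
have [[p0 _]|noX] := pselect (exists p : X, True); last first.
  rewrite [X in X #<= _](_ : _ = set0) ?card_ge0 //.
  by rewrite -subset0 => p _; apply: noX; exists p.
have [I [R [woR IK small]]] := ex_initial_well_order continuum.
have /choice[V VP] : forall S : set X, exists V : continuum -> set X,
    (forall i, open (V i) /\ closure S `<=` V i) /\
    (forall p, ~ closure S p -> exists i, ~ V i p).
  move=> S; apply: closed_pseudocharacter => //; exact: closed_closure.
have [S [gamma [t [discS clS coherent]]]] :
    exists (S : X -> set X) (gamma : X -> I) (t : X -> I -> continuum),
    [/\ forall p, discrete_subset (S p),
        forall p, closure (S p) p &
        forall p q, gamma p = gamma q ->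
          {in below R (gamma p), t p =1 t q} -> S p = S q].
  apply: (captured_by_branches _ p0 V woR) => [S i|S p|x].
  - by have [/(_ i)] := VP S.
  - by have [_ /(_ p)] := VP S.
  - apply: no_free_enumeration hatFP.1 _.
    by rewrite (card_le_eqr IK).
have /card_leT_inj[eI injI] : [set: I] #<= [set: continuum].
  by rewrite (card_le_eql IK).
have /choice[j injj] : forall g, exists j : (I -> continuum) -> continuum,
    forall u v, j u = j v -> {in below R g, u =1 v}.
  move=> g.
  have /card_fun_continuum/card_leT_inj[j injj] :
      [set: set (below R g)] #<= [set: continuum].
    apply: weak_power_c.1; split.
      by rewrite (card_le_eql (card_setT _)) -(card_le_eqr IK) card_leT.
    by rewrite (card_le_eqr (card_setT _)); apply: small.
  exists (fun u => j (fun b => u (val b))) => u v /injj uv b bg.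
  exact: (congr1 (@^~ (exist _ b bg)) uv).
have /choice[e inje] : forall D : set X, exists e : X -> continuum,
    closure D #<= [set: continuum] -> {in closure D &, injective e}.
  move=> D; have [/pcard_injP[e eP]|] := pselect (closure D #<= [set: continuum]).
    by exists e.
  by exists (fun=> set0).
(* [p] is coded by its stage, its branch below that stage, and its place in
   the closure of the set that captures it. *)
pose code p : nat -> continuum := fun n =>
  match n with
  | 0%N => eI (gamma p)
  | 1%N => j (gamma p) (t p)
  | _ => e (S p) p
  end.
apply: (inj_card_leT (fun p => uncurry_code (code p))) => p q.
move=> /uncurry_code_inj code_pq.
have /injI gpq : code p 0%N = code q 0%N by rewrite code_pq.
have tpq : {in below R (gamma p), t p =1 t q}.
  have : code p 1%N = code q 1%N by rewrite code_pq.
  by rewrite /code -gpq => /injj.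
have Spq := coherent p q gpq tpq.
have : code p 2%N = code q 2%N by rewrite code_pq.
rewrite /code -Spq; apply: (inje (S p)); rewrite ?inE //.
  exact/closure_le_c/discS.
by rewrite Spq.
Qed.
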